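(* For every even integer $d\ge 2$ and every odd integer $t\ge 3$, there exists a graph with treewidth at most $t$ that contains a distance-$d$ half graph of order $$ 2^{\binom{\frac12(d+t-5)}{\frac12(t-3)}}. $$
   Context: All graphs are finite, undirected and simple; $\mathrm{dist}$ is the shortest-path distance. For integers $d,\ell\ge1$, $2\ell$ pairwise distinct vertices $a_1,\dots,a_\ell,b_1,\dots,b_\ell$ of a graph form a distance-$d$ half graph of order $\ell$ if for all $i,j\in[1,\ell]$ we have $\mathrm{dist}(b_i,a_j)\le d$ if and only if $i<j$. Treewidth is the standard graph parameter (minimum over tree decompositions of the maximum bag size minus one). *)

(* Defs.v *)
From mathcomp Require Import all_boot.
From mathcomp Require Import boolp.

Set Implicit Arguments.
Unset Strict Implicit.
Unset Printing Implicit Defensive.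

Record sgraph := SGraph {
  vertex :> finType;
  adj : rel vertex;
  adj_sym : symmetric adj;
  adj_irrefl : irreflexive adj
}.

Section Distance.
Variable G : sgraph.
Implicit Types x y : G.

Definition walk x y (k : nat) : bool :=
  [exists p : k.-tuple G, path (@adj G) x p && (last x p == y)].

Lemma connect_walk x y : connect (@adj G) x y -> exists k, walk x y k.
Proof.
move=> /connectP[p xp ->]; exists (size p).
by apply/existsP; exists (in_tuple p); rewrite xp eqxx.
Qed.

(* None is the infinite distance between distinct connected components. *)
Definition dist x y : option nat :=
  if @idP (connect (@adj G) x y) is ReflectT xy
  then Some (ex_minn (connect_walk xy)) else None.

Definition dist_le x y (d : nat) : bool :=
  if dist x y is Some k then k <= d else false.

End Distance.

(* The indices 1, ..., l are shifted to 0, ..., l - 1. *)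
Definition half_graph (G : sgraph) (d l : nat) (a b : 'I_l -> G) : Prop :=
  [/\ injective a, injective b, (forall i j, a i != b j) &
      forall i j : 'I_l, dist_le (b i) (a j) d <-> i < j].

Definition contains_half_graph (G : sgraph) (d l : nat) : Prop :=
  exists a b : 'I_l -> G, half_graph d a b.

(* A ucycle of size 2 merely traverses an edge back and forth. *)
Definition is_tree (T : sgraph) : Prop :=
  [/\ 0 < #|T|, (forall x y : T, connect (@adj T) x y) &
      forall c : seq T, ucycle (@adj T) c -> size c <= 2].

Definition tree_decomposition (G T : sgraph) (B : T -> {set G}) : Prop :=
  [/\ is_tree T,
      (forall v : G, exists s : T, v \in B s),
      (forall u v : G, adj u v -> exists s : T, (u \in B s) && (v \in B s)) &
      forall (v : G) (s t : T), v \in B s -> v \in B t ->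
        connect [rel x y | [&& adj x y, v \in B x & v \in B y]] s t].

(* The predecessor is truncated, so the graph without vertices gets width 0
   instead of -1. *)
Definition width (G T : sgraph) (B : T -> {set G}) : nat :=
  (\max_(s : T) #|B s|).-1.

Definition has_width (G : sgraph) (k : nat) : Prop :=
  exists (T : sgraph) (B : T -> {set G}), tree_decomposition B /\ width B = k.

Lemma ex_has_width (G : sgraph) : exists k, `[< has_width G k >].
Proof.
pose r := [rel _ _ : unit | false].
have r_sym : symmetric r by [].
have r_irr : irreflexive r by [].
pose T := SGraph r_sym r_irr; pose B (_ : T) := [set: G].
exists (width B); apply/asboolP; exists T, B; split=> //; split.
- split; first by rewrite /= card_unit.
  + by move=> [] [].
  + by move=> [|[] [|[] c]] //=; rewrite andbF.
- by move=> v; exists tt; rewrite inE.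
- by move=> u v _; exists tt; rewrite !inE.
- by move=> v [] [].
Qed.

Definition treewidth (G : sgraph) : nat := ex_minn (ex_has_width G).

(* Main.v *)
(** Write d = 2(r+1) and t = 2k+3, so that the order is 2^C(r+k,k). By Pascal's
rule it suffices to build a half graph for (r+1,k+1) whose order is the product
of those for (r,k+1) and (r+1,k). Take the former as an outer graph and, for
each of its indices p, a copy of the latter; join every a-vertex of copy p to
the outer vertex a_p and every b-vertex to b_p. Between distinct copies p and q
the distance is that of b_p and a_q plus 2, and inside a copy a detour through
the outer graph never helps, because every b-vertex of a half graph is kept at
distance at least d from every a-vertex. The order of the result is thus
lexicographic. If some bag of the outer decomposition contains both a_p and b_p,
the decomposition of copy p, with a_p and b_p added to all its bags, can be hung
below that bag. Lower bounds on distances are certified by 1-Lipschitz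
functions. *)
Require Import Defs.
From mathcomp Require Import all_boot.
From mathcomp Require Import boolp zify.

Set Implicit Arguments.
Unset Strict Implicit.
Unset Printing Implicit Defensive.

(** * Distance bounds by walks and 1-Lipschitz functions *)

Definition reach (G : sgraph) (x y : G) (d : nat) : Prop :=
  exists p : seq G, [/\ path (@adj G) x p, last x p = y & size p <= d].

Lemma dist_leP (G : sgraph) (x y : G) d : dist_le x y d <-> reach x y d.
Proof.
rewrite /dist_le /dist; case: {-}_ / idP => [xy|nxy].
  case: ex_minnP => m /existsP[p /andP[xp /eqP yp]] m_min; split=> [md|].
    by exists p; rewrite size_tuple.
  move=> [q [xq yq /(leq_trans _)]]; apply; apply: m_min.
  by apply/existsP; exists (in_tuple q); rewrite xq yq eqxx.
split=> // -[p [xp yp _]]; case: nxy.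
by apply/connectP; exists p.
Qed.

(** One-sided, but [adj] is symmetric, so [f] changes by at most one along an edge. *)
Definition lipschitz (G : sgraph) (f : G -> nat) : Prop :=
  forall x y : G, adj x y -> f x <= (f y).+1.

Lemma lipschitz_reach (G : sgraph) (f : G -> nat) x y d :
  lipschitz f -> reach x y d -> f y <= f x + d.
Proof.
move=> f_lip [p [xp <- /(leq_add (leqnn (f x)))]]; apply: leq_trans.
elim: p x xp => [|z p IHp] x /=; first by rewrite addn0.
case/andP=> xz /IHp; have zx := xz; rewrite adj_sym in zx.
have := f_lip _ _ zx; lia.
Qed.

(* [D] bounds from below the distance to the set of all b-vertices. *)
Record layered_half_graph (G : sgraph) (d l : nat) (a b : 'I_l -> G) : Prop :=
  LayeredHalfGraph {
  layered_reach : forall i j : 'I_l, i < j -> reach (b i) (a j) d;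
  layered_potential : forall i : 'I_l, exists f : G -> nat,
    [/\ lipschitz f, f (b i) = 0, (forall j, d <= f (a j)) &
        forall j : 'I_l, j <= i -> d < f (a j)];
  layered_height : exists D : G -> nat,
    [/\ lipschitz D, (forall i, D (b i) = 0) & forall j, D (a j) = d]
}.

(** Injectivity: for [i < j], [b i] is within [d] of [a j], but neither [b j] is within [d] of [a j]
    nor [b i] of [a i]. The function [D] separates a-vertices from b-vertices. *)
Lemma layered_half_graphW (G : sgraph) d l (a b : 'I_l -> G) :
  0 < d -> layered_half_graph d a b -> half_graph d a b.
Proof.
move=> d_gt0 [ab_reach ab_far [D [_ Db Da]]].
have abP i j : dist_le (b i) (a j) d <-> i < j.
  split=> [/dist_leP ij|/ab_reach/dist_leP //].
  rewrite ltnNge; apply/negP => ji.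
  have [f [f_lip fb _ /(_ j ji)]] := ab_far i.
  by have := lipschitz_reach f_lip ij; lia.
split=> // [i j aij|i j bij|i j]; last first.
- by apply/eqP => /(congr1 D); rewrite Da Db; lia.
- apply/val_inj/eqP => /=; case: ltngtP => // ij.
    by have /abP := ij; rewrite bij => /abP; rewrite ltnn.
  by have /abP := ij; rewrite -bij => /abP; rewrite ltnn.
- apply/val_inj/eqP => /=; case: ltngtP => // ij.
    by have /abP := ij; rewrite -aij => /abP; rewrite ltnn.
  by have /abP := ij; rewrite aij => /abP; rewrite ltnn.
Qed.

(** * Rooted trees and rooted tree decompositions *)

Section RankedTree.
Variables (T : finType) (par : T -> T) (rk : T -> nat).

(* The edge from [x] to [par x] is present only if the rank decreases; the nodes
   where it does not are the roots. *)
Definition ranked_adj : rel T := fun x y =>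
  ((par x == y) && (rk y < rk x)) || ((par y == x) && (rk x < rk y)).

Lemma ranked_adj_sym : symmetric ranked_adj.
Proof. by move=> x y; rewrite /ranked_adj orbC. Qed.

Lemma ranked_adj_irrefl : irreflexive ranked_adj.
Proof. by move=> x; rewrite /ranked_adj ltnn !andbF. Qed.

Definition ranked_tree := SGraph ranked_adj_sym ranked_adj_irrefl.

(* Both neighbours on a cycle of a node of maximal rank are its parent. *)
Lemma ranked_tree_acyclic (c : seq ranked_tree) :
  ucycle (@adj ranked_tree) c -> size c <= 2.
Proof.
case: c => // x0 c /andP[c_cyc c_uniq]; set s := x0 :: c in c_cyc c_uniq *.
have [|x xs x_max] := @arg_maxnP _ x0 (mem s) rk; first exact: mem_head.
have par_adj y : y \in s -> ranked_adj x y -> par x = y.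
  by move=> /x_max/= yx /orP[/andP[/eqP] //|/andP[_]]; rewrite ltnNge yx.
have [i s' sE] := rot_to xs.
have mem_s' y : y \in s' -> y \in s.
  by move=> ys'; rewrite -(mem_rot i) sE inE ys' orbT.
rewrite -(size_rot i) -(rot_uniq i) -(rot_cycle i) sE in c_cyc c_uniq *.
case: s' mem_s' c_cyc c_uniq {sE} => [|y [|z s']] //= mem_s' /and3P[xy _].
rewrite rcons_path => /andP[_ last_x] /and3P[_ yzs _].
have lastE : par x = last z s'.
  apply: par_adj; last by rewrite ranked_adj_sym.
  by apply: mem_s'; rewrite inE mem_last orbT.
by rewrite -(par_adj _ (mem_s' y (mem_head _ _)) xy) lastE mem_last in yzs.
Qed.

(** Climbing to parents stays in [P] and lowers the rank, so it can only end at [top]. This serves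
    both for the whole tree and for the nodes whose bags contain a given vertex. *)
Lemma ranked_connect (P : pred T) (x top : T) :
  (forall s, P s -> s = top \/ rk (par s) < rk s /\ P (par s)) -> P x ->
  connect [rel s t | [&& ranked_adj s t, P s & P t]] x top.
Proof.
move=> P_par; have [n] := ubnP (rk x); elim: n x => // n IHn x xn Px.
have [->|[par_lt Ppar]] := P_par _ Px; first exact: connect0.
apply: connect_trans (IHn _ _ Ppar); last by lia.
by apply: connect1; rewrite /= /ranked_adj eqxx par_lt Px Ppar.
Qed.

End RankedTree.

(** Connectedness is made local: from any bag containing [v] one climbs through such bags to
    [top v]. Copies will be hung at the nodes [joint p]. The bound [w] is on bag sizes, not on the
    width. *)
Record rooted_decomposition (G : sgraph) (l : nat) (a b : 'I_l -> G) (w : nat)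
    : Type := RootedDecomposition {
  node : finType;
  root : node;
  parent : node -> node;
  rank : node -> nat;
  bag : node -> {set G};
  top : G -> node;
  root_or_parent : forall s, s = root \/ rank (parent s) < rank s;
  top_bag : forall v, v \in bag (top v);
  top_or_parent : forall v s, v \in bag s ->
    s = top v \/ rank (parent s) < rank s /\ v \in bag (parent s);
  edge_bag : forall u v, adj u v -> exists s, (u \in bag s) && (v \in bag s);
  card_bag : forall s, #|bag s| <= w;
  joint : 'I_l -> node;
  joint_a : forall p, a p \in bag (joint p);
  joint_b : forall p, b p \in bag (joint p)
}.

Lemma rooted_decomposition_treewidth (G : sgraph) l (a b : 'I_l -> G) w :
  rooted_decomposition a b w -> treewidth G <= w.-1.
Proof.
move=> [T r par rk B top r_par topB top_par edgeB cardB _ _ _].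
pose T' := ranked_tree par rk.
have sym_connect (P : pred T) :
    connect_sym [rel s t | [&& ranked_adj par rk s t, P s & P t]].
  by apply: sym_connect_sym => s t /=; rewrite ranked_adj_sym [P s && _]andbC.
have decB : @tree_decomposition G T' B.
  split=> [|v||v s t vs vt]; first split.
  - by apply/card_gt0P; exists r.
  - move=> x y; have all_par s : predT s ->
        s = r \/ rk (par s) < rk s /\ predT (par s).
      by case: (r_par s); [left | right].
    have to_r s := ranked_connect all_par (isT : predT s).
    apply: connect_sub (connect_trans (to_r x) _); last first.
      by rewrite (sym_connect predT); apply: to_r.
    by move=> s s' /and3P[ss' _ _]; apply: connect1.
  - exact: ranked_tree_acyclic.
  - by exists (top v).
  - exact: edgeB.
  - have to_top s' := @ranked_connect _ par rk [pred s | v \in B s] s' (top v)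
      (top_par v).
    apply: connect_trans (to_top s vs) _.
    by rewrite (sym_connect [pred s | v \in B s]); apply: to_top.
have width_le : @width G T' B <= w.-1.
  rewrite /width -!subn1 leq_sub2r //; apply/bigmax_leqP => s _.
  exact: cardB.
rewrite /treewidth; case: ex_minnP => m _ m_min; apply: leq_trans width_le.
by apply: m_min; apply/asboolP; exists T', B.
Qed.

(** * Lexicographic order on product indices *)

Section LexicographicIndex.
Variables m n : nat.

Fact lex_quo_subproof (i : 'I_(m * n)) : i %/ n < m.
Proof.
case: n i => [|n'] i; first by case: i => i; rewrite muln0.
by rewrite ltn_divLR.
Qed.

Fact lex_rem_subproof (i : 'I_(m * n)) : i %% n < n.
Proof.
case: n i => [|n'] i; first by case: i => i; rewrite muln0.
by rewrite ltn_mod.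
Qed.

Definition lex_quo i : 'I_m := Ordinal (lex_quo_subproof i).
Definition lex_rem i : 'I_n := Ordinal (lex_rem_subproof i).

Lemma lex_ltn (i j : 'I_(m * n)) :
  (i < j) =
  (lex_quo i < lex_quo j) || (lex_quo i == lex_quo j) && (lex_rem i < lex_rem j).
Proof.
rewrite -val_eqE /= [in LHS](divn_eq i n) [in LHS](divn_eq j n).
have := lex_rem_subproof i; have := lex_rem_subproof j.
move: (i %/ n) (j %/ n) (i %% n) (j %% n) => q q' r r' r'n rn.
case: (ltngtP q q') => [lt_q|lt_q|->] /=; last by rewrite ltn_add2l.
- by have : q.+1 * n <= q' * n by [rewrite leq_mul2r lt_q orbT]; lia.
- by have : q'.+1 * n <= q * n by [rewrite leq_mul2r lt_q orbT]; lia.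
Qed.

End LexicographicIndex.

(** * Substitution of inner copies into an outer half graph *)

Section Substitution.
Variables (O I : sgraph) (lo li : nat).
Variables (ao bo : 'I_lo -> O) (ai bi : 'I_li -> I).

Definition hangs (w : O) (p : 'I_lo) (x : I) : bool :=
  (w == ao p) && (x \in codom ai) || (w == bo p) && (x \in codom bi).

Definition subst_adj : rel (O + 'I_lo * I) := fun x y =>
  match x, y with
  | inl u, inl v => adj u v
  | inl w, inr (p, v) | inr (p, v), inl w => hangs w p v
  | inr (p, u), inr (q, v) => (p == q) && adj u v
  end.

Lemma subst_adj_sym : symmetric subst_adj.
Proof.
move=> [u|[p u]] [v|[q v]] //=; first exact: adj_sym.
by rewrite eq_sym adj_sym.
Qed.

Lemma subst_adj_irrefl : irreflexive subst_adj.
Proof. by move=> [u|[p u]] /=; rewrite adj_irrefl ?andbF. Qed.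

Definition subst_graph := SGraph subst_adj_sym subst_adj_irrefl.

Definition subst_a (i : 'I_(lo * li)) : subst_graph :=
  inr (lex_quo i, ai (lex_rem i)).
Definition subst_b (i : 'I_(lo * li)) : subst_graph :=
  inr (lex_quo i, bi (lex_rem i)).

(** The last two hypotheses treat the joining edges, the only ones not inside [O] or a copy. *)
Lemma subst_lipschitz (f : O -> nat) (g : 'I_lo -> I -> nat) :
  lipschitz f -> (forall p, lipschitz (g p)) ->
  (forall p j, g p (ai j) <= (f (ao p)).+1 /\ f (ao p) <= (g p (ai j)).+1) ->
  (forall p j, g p (bi j) <= (f (bo p)).+1 /\ f (bo p) <= (g p (bi j)).+1) ->
  @lipschitz subst_graph
    (fun v => match v with inl w => f w | inr (p, x) => g p x end).
Proof.
move=> f_lip g_lip fga fgb [u|[p u]] [v|[q v]] /=.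
- exact: f_lip.
- case/orP=> /andP[/eqP-> /codomP[j ->]]; first by case: (fga q j).
  by case: (fgb q j).
- case/orP=> /andP[/eqP-> /codomP[j ->]]; first by case: (fga p j).
  by case: (fgb p j).
- by case/andP=> /eqP-> /g_lip.
Qed.

Lemma reach_inl (u v : O) d :
  reach u v d -> @reach subst_graph (inl u) (inl v) d.
Proof.
move=> [p [up <- pd]]; exists (map inl p); rewrite size_map last_map.
by split=> //; rewrite (@map_path _ _ _ _ (@adj O) xpred0) //; apply/hasP => -[].
Qed.

Lemma reach_inr p (u v : I) d :
  reach u v d -> @reach subst_graph (inr (p, u)) (inr (p, v)) d.
Proof.
move=> [s [us <- sd]]; exists (map (fun x => inr (p, x)) s).
rewrite size_map (last_map (fun x => inr (p, x))); split=> //.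
rewrite (@map_path _ _ _ _ (@adj I) xpred0) //; last by apply/hasP => -[].
by move=> x y _ /=; rewrite eqxx.
Qed.

Lemma subst_layered d :
  0 < d -> layered_half_graph d ao bo -> layered_half_graph d.+2 ai bi ->
  layered_half_graph d.+2 subst_a subst_b.
Proof.
move=> d_gt0 [o_reach o_far [Do [Do_lip Dob Doa]]].
move=> [i_reach i_far [Di [Di_lip Dib Dia]]].
split=> [i j|i|].
- rewrite lex_ltn => /orP[lt_ij|/andP[/eqP eq_ij lt_ij]]; last first.
    by rewrite /subst_b /subst_a eq_ij; apply/reach_inr/i_reach.
  (* Distinct copies: an outer walk of length at most [d] between two joining edges. *)
  have [s [path_s last_s size_s]] := reach_inl (o_reach _ _ lt_ij).
  exists (inl (bo (lex_quo i)) :: rcons s (subst_a j)).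
  rewrite /= rcons_path path_s last_s last_rcons size_rcons /= /hangs.
  by rewrite !eqxx !codom_f orbT.
- have [fo [fo_lip fo_b fo_d fo_far]] := o_far (lex_quo i).
  have [fi [fi_lip fi_b fi_d fi_far]] := i_far (lex_rem i).
  (* A vertex of another copy is reached through its outer b-vertex or its
     outer a-vertex; in the copy of the source only the former can help. *)
  pose f w := minn d.+3 (fo w).+1.
  pose g p x := if p == lex_quo i then minn d.+3 (minn (Di x).+2 (fi x))
    else minn d.+3 (minn (f (bo p) + (Di x).+1) (f (ao p) + (d.+3 - Di x))).
  exists (fun v => match v with inl w => f w | inr (p, x) => g p x end).
  split.
  + apply: subst_lipschitz => [x y /fo_lip|p x y xy|p j|p j].
    * by rewrite /f; lia.
    * have yx : adj y x by rewrite adj_sym.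
      have := Di_lip _ _ yx; have := Di_lip _ _ xy; have := fi_lip _ _ xy.
      by rewrite /g; case: ifP; lia.
    (* In the source copy, [fo_far] and [fi_d] leave only [d.+2] and [d.+3] for both values. *)
    * have := fo_d p; have := Dia j; have := fi_d j; rewrite /g /f.
      by case: eqP => [->|_]; first have := fo_far _ (leqnn _); lia.
    * have := Dib j; have := fo_d p; rewrite /g /f.
      by case: eqP => [->|_]; lia.
  + by rewrite /subst_b /g eqxx fi_b minn0.
  (* In another copy [p], [f (ao p)] is at least [d.+1], and entering there costs one more step. *)
  + move=> j; rewrite /subst_a /g /f; have := Dia (lex_rem j).
    have := fi_d (lex_rem j); have := fo_d (lex_quo j).
    by case: eqP => _; lia.
  (* The extra unit comes from [fo_far] in an earlier copy and from [fi_far] in the source copy. *)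
  + move=> j; rewrite leqNgt lex_ltn /subst_a /g /f; have := Dia (lex_rem j).
    have := fi_far (lex_rem j); have := fo_far (lex_quo j).
    move: (lex_quo j) (lex_rem j) => p q; rewrite -!val_eqE.
    by case: (ltngtP (val p) (val (lex_quo i))) => //=; lia.
(* The shift puts 1 at [bo p] and [d.+1] at [ao p], next to the inner values 0 and [d.+2]. *)
- exists (fun v => match v with inl w => (Do w).+1 | inr (_, x) => Di x end).
  split=> [|i|j]; [|exact: Dib|exact: Dia].
  apply: subst_lipschitz => [x y /Do_lip|//|p j|p j]; first by lia.
  + by rewrite Doa Dia; lia.
  + by rewrite Dob Dib; lia.
Qed.

Lemma subst_rooted_decomposition w :
  rooted_decomposition ao bo w.+2 -> rooted_decomposition ai bi w ->
  rooted_decomposition subst_a subst_b w.+2.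
Proof.
move=> [To ro paro rko Bo topo ro_par topoB topo_par edgeo cardo jo jo_a jo_b].
move=> [Ti ri pari rki Bi topi ri_par topiB topi_par edgei cardi ji ji_a ji_b].
(* Only the inner root can lack a parent of smaller rank; it is then attached to [jo p]. *)
pose par (s : To + 'I_lo * Ti) : To + 'I_lo * Ti :=
  match s with
  | inl s => inl (paro s)
  | inr (p, s) => if rki (pari s) < rki s then inr (p, pari s) else inl (jo p)
  end.
(* Inner ranks exceed all outer ones, so passing to [jo p] lowers the rank. *)
pose rk (s : To + 'I_lo * Ti) :=
  match s with
  | inl s => rko s
  | inr (_, s) => (\max_t rko t).+1 + rki s
  end.
pose B (s : To + 'I_lo * Ti) : {set subst_graph} :=
  match s with
  | inl s => inl @: Bo s
  | inr (p, s) =>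
      [set inl (ao p); inl (bo p)] :|: [set inr (p, x) | x in Bi s]
  end.
pose top (v : subst_graph) : To + 'I_lo * Ti :=
  match v with inl v => inl (topo v) | inr (p, v) => inr (p, topi v) end.
have inl_inj : injective (inl : O -> subst_graph) by move=> x y [].
have inr_inj p : injective (fun x => inr (p, x) : subst_graph) by move=> x y [].
have in_inl s v : (inl v \in B (inl s)) = (v \in Bo s) by exact: mem_imset.
have in_inr p s v : (inr (p, v) \in B (inr (p, s))) = (v \in Bi s).
  by rewrite !inE /= (mem_imset _ _ (inr_inj p)).
have inr_par p s : rk (par (inr (p, s))) < rk (inr (p, s)).
  rewrite /=; case: ifP => [|_] /=; first by rewrite ltn_add2l.
  by have := @leq_bigmax _ rko (jo p); lia.
apply: (@RootedDecomposition _ _ _ _ _ _ (inl ro) par rk B top _ _ _ _ _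
  (fun i => inr (lex_quo i, ji (lex_rem i)))).
- move=> [s|[p s]]; last by right; apply: inr_par.
  by case: (ro_par s) => [->|]; [left | right].
- by move=> [v|[p v]]; rewrite ?in_inl ?in_inr.
- move=> [v|[p v]] [s|[q s]].
  + by rewrite /= !in_inl => /topo_par[->|[]]; [left | right].
  + move=> vB; right; split; first exact: inr_par.
    (* Both candidates lie in every bag of copy [q] and in that of [jo q], hence in the parent
       bag. *)
    have {vB} : v = ao q \/ v = bo q.
      move: vB; rewrite !inE => /orP[/orP[]/eqP[->]|/imsetP[] //]; by [left|right].
    rewrite /=; case: ifP => _ [] ->; by rewrite ?in_inl // !inE eqxx ?orbT.
  + by case/imsetP.
  + rewrite inE => /orP[|/imsetP[x xs [-> ->]]]; first by rewrite !inE.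
    case: (topi_par _ _ xs) => [->|[lt_s xs']]; [by left | right].
    by split; [exact: inr_par | rewrite /= lt_s in_inr].
- have hangsB w' p x : hangs w' p x ->
      exists s, (inl w' \in B s) && (inr (p, x) \in B s).
    move=> wpx; exists (inr (p, topi x)); rewrite in_inr topiB andbT !inE.
    by case/orP: wpx => /andP[/eqP-> _]; rewrite eqxx ?orbT.
  move=> [u|[p u]] [v|[q v]] /=.
  + by case/edgeo => s uvs; exists (inl s); rewrite !in_inl.
  + exact: hangsB.
  + by case/hangsB => s; rewrite andbC; exists s.
  + by case/andP=> /eqP-> /edgei[s uvs]; exists (inr (q, s)); rewrite !in_inr.
- move=> [s|[p s]]; first by rewrite card_imset.
  apply: leq_trans (leq_card_setU _ _) _; rewrite card_imset // -[w.+2]add2n.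
  by rewrite leq_add // cards2 ltnS leq_b1.
- by move=> i; rewrite /subst_a in_inr.
- by move=> i; rewrite /subst_b in_inr.
Qed.

End Substitution.

(** * The base case: a half graph of order two *)

Section PathGraph.
Variable d : nat.

(* The vertices 0 and d.+2 are isolated. *)
Definition path_adj : rel 'I_d.+3 := fun x y =>
  [&& 0 < x, y < d.+2 & x.+1 == y] || [&& 0 < y, x < d.+2 & y.+1 == x].

Lemma path_adj_sym : symmetric path_adj.
Proof. by move=> x y; rewrite /path_adj orbC. Qed.

Lemma path_adj_irrefl : irreflexive path_adj.
Proof. by move=> x; rewrite /path_adj; lia. Qed.

Definition path_graph := SGraph path_adj_sym path_adj_irrefl.

(** Only [path_b] at 0 and [path_a] at 1 must be close: they are the ends of a path of length [d].
    The other two vertices are isolated. *)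
Definition path_a (i : 'I_2) : path_graph :=
  inord (if i == 0 :> nat then 0 else d.+1).
Definition path_b (i : 'I_2) : path_graph :=
  inord (if i == 0 :> nat then 1 else d.+2).

Lemma val_path_a i : path_a i = (if i == 0 :> nat then 0 else d.+1) :> nat.
Proof. by rewrite inordK //; case: ifP. Qed.

Lemma val_path_b i : path_b i = (if i == 0 :> nat then 1 else d.+2) :> nat.
Proof. by rewrite inordK //; case: ifP. Qed.

Lemma path_reach k : k <= d -> @reach path_graph (inord 1) (inord k.+1) k.
Proof.
elim: k => [|k IHk] kd; first by exists [::].
have [p [path_p last_p size_p]] := IHk (ltnW kd).
exists (rcons p (inord k.+2)); rewrite rcons_path path_p last_p last_rcons.
by split; rewrite ?size_rcons //= /path_adj !inordK; lia.
Qed.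

Lemma path_layered : 0 < d -> layered_half_graph d path_a path_b.
Proof.
move=> d_gt0; split=> [i j ij|i|].
- have [i0 j1] : nat_of_ord i = 0 /\ nat_of_ord j = 1 by have := ltn_ord j; lia.
  by rewrite /path_a /path_b i0 j1; apply: path_reach.
(* [f0] is the distance from 1 along the path. Values at isolated vertices are free, so [f1] may
   jump from 0 to [d.+1]. *)
- pose f0 (x : path_graph) := if (x == 0 :> nat) then d.+1 else x.-1.
  pose f1 (x : path_graph) := if (x == d.+2 :> nat) then 0 else d.+1.
  exists (if i == 0 :> nat then f0 else f1).
  have := ltn_ord i; case: eqP => [i0|i_neq0] _; split=> [x y|||].
  + by rewrite /= /path_adj /f0; case: ifP => ?; case: ifP => ?; lia.
  + by rewrite /f0 val_path_b i0.
  + move=> j; rewrite /f0 val_path_a.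
    by case: (j == 0 :> nat) => /=; do ?case: ifP; lia.
  + by move=> j; rewrite i0 leqn0 /f0 val_path_a => ->.
  + by rewrite /= /path_adj /f1; case: ifP => ?; case: ifP => ?; lia.
  + by rewrite /f1 val_path_b; move/eqP/negPf: i_neq0 => ->; rewrite eqxx.
  + move=> j; rewrite /f1 val_path_a.
    by case: (j == 0 :> nat) => /=; do ?case: ifP; lia.
  + move=> j _; rewrite /f1 val_path_a.
    by case: (j == 0 :> nat) => /=; do ?case: ifP; lia.
- exists (fun x : path_graph => if x == 0 :> nat then d
                                else if x == d.+2 :> nat then 0 else x.-1).
  split=> [x y|i|j]; first by rewrite /= /path_adj; do ![case: ifP => ?]; lia.
  + by rewrite val_path_b; case: (i == 0 :> nat) => /=; do ?case: ifP; lia.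
  + by rewrite val_path_a; case: (j == 0 :> nat) => /=; do ?case: ifP; lia.
Qed.

(** The bags of consecutive numbers run through the isolated vertices too, so [path_a i] and
    [path_b i] share a bag without being adjacent. *)
Lemma path_rooted_decomposition w :
  2 <= w -> rooted_decomposition path_a path_b w.
Proof.
move=> w_ge2.
pose pr (s : 'I_d.+3) : 'I_d.+3 := inord s.-1.
have val_pr s : pr s = s.-1 :> nat by rewrite inordK //; have := ltn_ord s; lia.
apply: (@RootedDecomposition path_graph 2 _ _ _ 'I_d.+3 ord0 pr
  (@nat_of_ord _) (fun s => [set s; pr s]) id _ _ _ _ _
  (fun i => if i == 0 :> nat then inord 1 else inord d.+2)).
- move=> s; rewrite val_pr; case: (posnP s) => [s0|s_gt0].
    by left; apply: val_inj.
  by right; lia.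
- by move=> v; rewrite !inE eqxx.
- move=> v s; rewrite !inE val_pr => /orP[/eqP->|/eqP v_eq]; first by left.
  case: (posnP s) => [s0|s_gt0]; last by right; split; [lia | rewrite v_eq eqxx].
  by left; apply: val_inj; rewrite v_eq /= val_pr; lia.
- move=> u v /=; rewrite /path_adj => uv.
  have [uv'|uv'] : v.-1 = u /\ u < v \/ u.-1 = v /\ v < u by lia.
  + exists v; rewrite !inE eqxx /= andbT; apply/orP; right; apply/eqP/val_inj.
    by rewrite /= val_pr; case: uv'.
  + exists u; rewrite !inE eqxx /=; apply/orP; right; apply/eqP/val_inj.
    by rewrite /= val_pr; case: uv'.
- by move=> s; apply: leq_trans w_ge2; rewrite cards2; case: eqP.
- move=> i; rewrite !inE; case: ifP => i0; apply/orP; right; apply/eqP/val_inj;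
    by rewrite /= val_pr val_path_a i0 inordK.
- by move=> i; rewrite !inE /path_b; case: ifP; rewrite eqxx.
Qed.

End PathGraph.

(** * Double induction and choice of parameters *)

Lemma layered_half_graph_exists r k :
  exists (G : sgraph) (a b : 'I_(2 ^ 'C(r + k, k)) -> G),
    layered_half_graph r.*2.+2 a b /\
    inhabited (rooted_decomposition a b k.*2.+2).
Proof.
have base r' w : exists (G : sgraph) (a b : 'I_2 -> G),
    layered_half_graph r'.*2.+2 a b /\ inhabited (rooted_decomposition a b w.+2).
  exists (path_graph r'.*2.+2), (@path_a _), (@path_b _); split.
    exact: path_layered.
  by split; apply: path_rooted_decomposition.
(* The binomial coefficient is 1 when [r] or [k] is 0, and the path works for any value of the
   other. *)
elim: r k => [k|r IHr]; first by rewrite add0n binn; apply: base.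
elim=> [|k IHk]; first by rewrite bin0; apply: base.
(* From outer to inner graph, the distance grows by 2 and the bag bound drops by 2, as substitution
   requires. *)
have [O [ao [bo [o_layered [o_dec]]]]] := IHr k.+1.
have [I [ai [bi [i_layered [i_dec]]]]] := IHk.
have -> : 2 ^ 'C(r.+1 + k.+1, k.+1) = 2 ^ 'C(r + k.+1, k.+1) * 2 ^ 'C(r.+1 + k, k).
  by rewrite addnS binS expnD addSnnS.
exists (subst_graph ao bo ai bi), (@subst_a _ _ _ _ ao bo ai bi).
exists (@subst_b _ _ _ _ ao bo ai bi); split; first exact: subst_layered.
by split; apply: subst_rooted_decomposition.
Qed.

Theorem theorem3p15 (d t : nat) :
  ~~ odd d -> 2 <= d -> odd t -> 3 <= t ->
  exists G : sgraph,
    treewidth G <= t /\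
    contains_half_graph G d (2 ^ 'C((d + t - 5) %/ 2, (t - 3) %/ 2)).
Proof.
move=> d_even d_ge2 t_odd t_ge3.
have [r dE] : exists r, d = r.*2.+2 by exists (d./2).-1; lia.
have [k tE] : exists k, t = k.*2.+3 by exists (t./2).-1; lia.
have -> : (d + t - 5) %/ 2 = r + k by lia.
have -> : (t - 3) %/ 2 = k by lia.
have [G [a [b [ab_layered [ab_dec]]]]] := layered_half_graph_exists r k.
exists G; split; last by exists a, b; apply: layered_half_graphW; rewrite dE.
(* Bags of size at most [k.*2.+2] give treewidth at most [k.*2.+1]. *)
by have := rooted_decomposition_treewidth ab_dec; lia.
Qed.
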